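(* For $i=1,2,\ldots,n$, let $G_i=\{\underline{a_i}\mid\underline{0}\mid\underline{c_i}\}$ be simple hot games with the standard indexing, and let $G=G_1+G_2+\cdots+G_n$. The index-order strategy for Left is an optimal strategy for playing $G$. For Right, the matching strategy $\alpha(M)$ from a minimum weight matching $M$ in $D_G$ is an optimal strategy.
   Context: Integers as games: $\underline 0$ has no moves; for $n>0$, $\underline n$ is the game in which Left has $n$ consecutive moves and Right none; for $n<0$, $\underline{n}$ is the game in which Right has $-n$ consecutive moves and Left none. A (normalized) simple hot game $\{\underline{a}\mid\underline{0}\mid\underline{c}\}$, with integers $a\ge 0\ge c$, is a game in which each player has exactly one move: if only Left moves in it, it becomes $\underline a$; if only Right moves in it, it becomes $\underline c$; if both move in it in the same round it becomes $\underline 0$. Play of $G=G_1+\cdots+G_n$ (disjunctive sum, Cheating Robot play): in each round Left chooses a component $G_i$ not yet played in; then Right, knowing Left's choice, chooses a component $G_j$ that was not yet played in at the beginning of the round (possibly $j=i$). If $j=i$ then $G_i$ becomes $\underline 0$; if $j\ne i$ then $G_i$ becomes $\underline{a_i}$ and $G_j$ becomes $\underline{c_j}$. Play continues until every component has become an integer; the result is the sum of these integers. Left wants to maximize and Right wants to minimize this resulting integer, and a strategy is optimal if it guarantees its player the optimal (minimax) value of the result. Standard indexing: $a_i-c_i\ge a_{i+1}-c_{i+1}$ for $i=1,\ldots,n-1$ (with ties ordered arbitrarily). The index-order strategy for Left is always to play in the not-yet-played simple hot game of least index. The auxiliary graph $D_G$ has vertex set $\{1,\ldots,n\}$; for $i<j$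 the edge $ij$ exists if $a_i+c_j<0$, and it then has weight $w(ij)=a_i+c_j$; there is also a loop of weight $0$ at each vertex. For a matching $M$ of $D_G$ (a set of pairwise disjoint non-loop edges; vertices not covered may be regarded as covered by their loops), its weight is the sum of the weights of its edges, and a minimum weight matching is one minimizing this weight. The matching strategy $\alpha(M)$ for Right is: if $ij\in M$ and Left plays in one of $G_i,G_j$, Right responds in the other one; if $i$ is not incident with an edge of $M$ and Left plays in $G_i$, Right responds in $G_i$. *)

(* Defs.v *)
(* Components and vertices are indexed by 'I_n, i.e. from 0. *)
From mathcomp Require Import all_boot all_order all_algebra.

Set Implicit Arguments.
Unset Strict Implicit.
Unset Printing Implicit Defensive.

Import Order.TTheory GRing.Theory Num.Theory.
Local Open Scope ring_scope.

(* The normalized simple hot game { a | 0 | c } with a >= 0 >= c. *)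
Record simple_hot := SimpleHot {
  hotL : int;
  hotR : int;
  hot_sign : hotR <= 0 <= hotL }.

(* An integer game is recorded by the integer it is worth. *)
Inductive component := Hot of simple_hot | Integer of int.

(* The outcomes of a round in one component, when only Left, only Right or
   both move in it. The [Integer] branches never arise in a legal round. *)
Definition moveL (x : component) : component :=
  if x is Hot g then Integer (hotL g) else x.

Definition moveR (x : component) : component :=
  if x is Hot g then Integer (hotR g) else x.

Definition moveLR (x : component) : component :=
  if x is Hot _ then Integer 0 else x.

Definition position (n : nat) := {ffun 'I_n -> component}.

Definition hot_sum (n : nat) (G : 'I_n -> simple_hot) : position n :=
  [ffun i => Hot (G i)].

Definition unplayed (n : nat) (p : position n) : pred 'I_n :=
  fun i => if p i is Hot _ then true else false.

Definition finished (n : nat) (p : position n) : bool :=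
  [forall i, ~~ unplayed p i].

(* Only meaningful at finished positions. *)
Definition result (n : nat) (p : position n) : int :=
  \sum_(i < n) (if p i is Integer z then z else 0).

(* Left plays in component i and Right in component j. *)
Definition play_round (n : nat) (p : position n) (i j : 'I_n) : position n :=
  [ffun k => if k == i then (if j == i then moveLR (p k) else moveL (p k))
             else if k == j then moveR (p k) else p k].

(* Max over Left's choice i, then min over Right's reply j. The default value
   of each iterated max/min is one of the values being compared (playing in i
   is a legal reply to i), so it does not affect the result. The argument k
   bounds the number of remaining rounds. *)
Fixpoint minimax (n k : nat) (p : position n) : int :=
  if k is k'.+1 then
    let reply i j := minimax k' (play_round p i j) in
    let best_reply i := \big[Num.min/reply i i]_(j | unplayed p j) reply i j in
    if [pick i | unplayed p i] is Some i0
    then \big[Num.max/best_reply i0]_(i | unplayed p i) best_reply i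
    else result p
  else result p.

Definition minimax_value (n : nat) (p : position n) : int :=
  minimax #|unplayed p| p.

(* A strategy may prescribe nothing, or an illegal move, at some positions;
   that this never happens in actual play is part of [left_guarantees] and
   [right_guarantees]. *)
Definition left_strategy (n : nat) := position n -> option 'I_n.

Definition right_strategy (n : nat) := position n -> 'I_n -> 'I_n.

(* Positions reachable from p when Left follows s and Right plays any legal
   moves; next the same with the roles exchanged. *)
Inductive left_reach (n : nat) (s : left_strategy n) (p : position n) :
    position n -> Prop :=
  | left_reach_start : left_reach s p p
  | left_reach_round q i j :
      left_reach s p q -> s q = Some i -> unplayed q i -> unplayed q j ->
      left_reach s p (play_round q i j).

Inductive right_reach (n : nat) (s : right_strategy n) (p : position n) :
    position n -> Prop :=
  | right_reach_start : right_reach s p p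
  | right_reach_round q i :
      right_reach s p q -> unplayed q i -> unplayed q (s q i) ->
      right_reach s p (play_round q i (s q i)).

Definition left_guarantees (n : nat) (s : left_strategy n) (p : position n)
    (v : int) : Prop :=
  forall q, left_reach s p q ->
    (finished q -> v <= result q) /\
    (~~ finished q -> exists2 i, s q = Some i & unplayed q i).

Definition right_guarantees (n : nat) (s : right_strategy n) (p : position n)
    (v : int) : Prop :=
  forall q, right_reach s p q ->
    (finished q -> result q <= v) /\
    (forall i, unplayed q i -> unplayed q (s q i)).

Definition left_optimal (n : nat) (s : left_strategy n) (p : position n) :=
  left_guarantees s p (minimax_value p).

Definition right_optimal (n : nat) (s : right_strategy n) (p : position n) :=
  right_guarantees s p (minimax_value p).

Definition standard_indexing (n : nat) (G : 'I_n -> simple_hot) : Prop :=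
  forall i j : 'I_n, j = i.+1 :> nat ->
    hotL (G j) - hotR (G j) <= hotL (G i) - hotR (G i).

Definition index_order (n : nat) : left_strategy n :=
  fun p => [pick i | unplayed p i && [forall j, unplayed p j ==> (i <= j)%N]].

(* An undirected edge is the pair e of its endpoints with e.1 <= e.2. *)
Definition DG_edge (n : nat) (G : 'I_n -> simple_hot) (e : 'I_n * 'I_n) : bool :=
  (e.1 == e.2) || ((e.1 < e.2)%N && (hotL (G e.1) + hotR (G e.2) < 0)).

Definition DG_weight (n : nat) (G : 'I_n -> simple_hot) (e : 'I_n * 'I_n) : int :=
  if e.1 == e.2 then 0 else hotL (G e.1) + hotR (G e.2).

Definition endpoints (n : nat) (e : 'I_n * 'I_n) : {set 'I_n} := [set e.1; e.2].

Definition matching (n : nat) (G : 'I_n -> simple_hot)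
    (M : {set 'I_n * 'I_n}) : Prop :=
  (forall e, e \in M -> DG_edge G e /\ e.1 != e.2) /\
  (forall e f, e \in M -> f \in M -> e != f ->
     [disjoint endpoints e & endpoints f]).

Definition matching_weight (n : nat) (G : 'I_n -> simple_hot)
    (M : {set 'I_n * 'I_n}) : int :=
  \sum_(e in M) DG_weight G e.

Definition min_weight_matching (n : nat) (G : 'I_n -> simple_hot)
    (M : {set 'I_n * 'I_n}) : Prop :=
  matching G M /\
  forall M', matching G M' -> matching_weight G M <= matching_weight G M'.

Definition matching_strategy (n : nat) (M : {set 'I_n * 'I_n}) :
    right_strategy n :=
  fun _ i => if [pick j | ((i, j) \in M) || ((j, i) \in M)] is Some j
             then j else i.

(* Main.v *)
Require Import Defs.
From mathcomp Require Import all_boot all_order all_algebra.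
From mathcomp Require Import lra.

(** Both strategies are compared with a single number: the minimum weight [w]
of a matching of the auxiliary graph.

A round in which Left plays in [i] and Right in [j] adds exactly
[DG_weight G (i, j)] to the sum of the integers already on the board
([result_play_round]), with the loops of the graph accounting for the rounds in
which Right answers in the same component. A whole play is thus a set of
disjoint pairs and loops covering all the vertices, and its result is their
total weight.

If Left plays in index order then [i] is always the smaller element of its
pair. The pairs of negative weight are then edges and form a matching, and
dropping the other pairs does not increase the weight, so the result is at least
[w] ([left_reach_index_order]). If Right follows [matching_strategy M], the
rounds are the edges of [M] and the loops at the uncovered vertices. Left may
start an edge [ij], [i < j], from its larger end [j], but then the round is
worth [a_j + c_i <= a_i + c_j] because of the standard indexing
([DG_weight_swap]). The result is therefore at most the weight of [M]
([right_reach_matching]).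

Since what either player can guarantee bounds the minimax value
([left_guarantees_le_minimax], [right_guarantees_ge_minimax]), this value is
[w], and both strategies guarantee it. *)

Set Implicit Arguments.
Unset Strict Implicit.
Unset Printing Implicit Defensive.

Import Order.TTheory GRing.Theory Num.Theory.
Local Open Scope ring_scope.

(** * The effect of a round *)

Lemma unplayed_play_round n (p : position n) (i j k : 'I_n) :
  unplayed (play_round p i j) k = [&& unplayed p k, k != i & k != j].
Proof.
rewrite /unplayed /play_round ffunE.
case: (eqVneq k i) => [->|_]; first by case: eqP; case: (p i).
by case: (eqVneq k j) => _; case: (p k).
Qed.

Lemma unplayed_hot_sum n (G : 'I_n -> simple_hot) (i : 'I_n) :
  unplayed (hot_sum G) i.
Proof. by rewrite /unplayed ffunE. Qed.

Lemma card_unplayed_play_round n (p : position n) (i j : 'I_n) :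
  unplayed p i -> (#|unplayed (play_round p i j)| < #|unplayed p|)%N.
Proof.
move=> pi; apply: proper_card; apply/properP; split.
  by apply/subsetP => k; rewrite -!topredE /= unplayed_play_round => /and3P[].
by exists i; rewrite -?topredE //= unplayed_play_round eqxx andbF.
Qed.

Definition remains_of n (G : 'I_n -> simple_hot) (p : position n) :=
  forall i, unplayed p i -> p i = Hot (G i).

Lemma remains_of_hot_sum n (G : 'I_n -> simple_hot) :
  remains_of G (hot_sum G).
Proof. by move=> i _; rewrite ffunE. Qed.

Lemma remains_of_play_round n (G : 'I_n -> simple_hot) p i j :
  remains_of G p -> remains_of G (play_round p i j).
Proof.
move=> Gp k; rewrite unplayed_play_round ffunE.
by case/and3P=> pk /negPf-> /negPf->; apply: Gp.
Qed.

Lemma result_hot_sum n (G : 'I_n -> simple_hot) : result (hot_sum G) = 0.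
Proof. by rewrite /result big1 // => i _; rewrite ffunE. Qed.

(** The weight of a pair or of a loop, which is meaningful even for a pair that
is not an edge, is the worth of the round played there. *)
Lemma result_play_round n (G : 'I_n -> simple_hot) (p : position n) i j :
  remains_of G p -> unplayed p i -> unplayed p j ->
  result (play_round p i j) = result p + DG_weight G (i, j).
Proof.
move=> Gp /Gp pi /Gp pj; rewrite /result /DG_weight /=.
have [<-|ij] := eqVneq i j.
  rewrite addr0; apply: eq_bigr => k _; rewrite ffunE.
  by case: (eqVneq k i) => [->|//]; rewrite eqxx pi.
have ji : j != i by rewrite eq_sym.
rewrite (bigD1 i) // (bigD1 j) //= [in RHS](bigD1 i) // [in RHS](bigD1 j) //=.
rewrite !ffunE !eqxx (negPf ji) pi pj /= !add0r addrA addrC.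
congr (_ + _); apply: eq_bigr => k /andP[/negPf ki /negPf kj].
by rewrite ffunE ki kj.
Qed.

(** * Guarantees bound the minimax value *)

Lemma left_reach_first n (s : left_strategy n) p i j q :
  s p = Some i -> unplayed p i -> unplayed p j ->
  left_reach s (play_round p i j) q -> left_reach s p q.
Proof.
move=> sp pi pj; elim=> [|r k l _ IH sr rk rl]; last exact: left_reach_round.
exact: left_reach_round (left_reach_start s p) sp pi pj.
Qed.

Lemma right_reach_first n (s : right_strategy n) p i q :
  unplayed p i -> unplayed p (s p i) ->
  right_reach s (play_round p i (s p i)) q -> right_reach s p q.
Proof.
move=> pi pj; elim=> [|r k _ IH rk rl]; last exact: right_reach_round.
exact: right_reach_round (right_reach_start s p) pi pj.
Qed.

(** The bound is proved for any large enough fuel, since a round uses one unit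
of fuel but may settle two components. *)
Lemma left_guarantees_le_minimax n (s : left_strategy n) p v :
  left_guarantees s p v -> v <= minimax_value p.
Proof.
rewrite /minimax_value; move: (leqnn #|unplayed p|).
move: {2 3}#|_| => k; elim: k p => [|k IH] p le_pk sv /=.
  apply: (sv p (left_reach_start _ _)).1; apply/forallP=> i.
  by apply/negP => pi; move: le_pk; rewrite leqn0 => /eqP/card0_eq/(_ i)/negP.
case: pickP => [i0 pi0|p0]; last first.
  by apply: (sv p (left_reach_start _ _)).1; apply/forallP=> i; rewrite p0.
have [|i sp pi] := (sv p (left_reach_start _ _)).2.
  by apply/forallPn; exists i0; rewrite negbK.
have le_reply j : unplayed p j -> v <= minimax k (play_round p i j).
  move=> pj; apply: IH => [|q qr]; last first.
    exact/sv/(left_reach_first sp pi pj qr).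
  by rewrite -ltnS; apply: leq_trans le_pk; apply: card_unplayed_play_round.
apply: (bigmax_sup i) => //.
by apply/bigmin_geP; split=> [|j]; apply: le_reply.
Qed.

Lemma right_guarantees_ge_minimax n (s : right_strategy n) p v :
  right_guarantees s p v -> minimax_value p <= v.
Proof.
rewrite /minimax_value; move: (leqnn #|unplayed p|).
move: {2 3}#|_| => k; elim: k p => [|k IH] p le_pk sv /=.
  apply: (sv p (right_reach_start _ _)).1; apply/forallP=> i.
  by apply/negP => pi; move: le_pk; rewrite leqn0 => /eqP/card0_eq/(_ i)/negP.
case: pickP => [i0 pi0|p0]; last first.
  by apply: (sv p (right_reach_start _ _)).1; apply/forallP=> i; rewrite p0.
suff best_le i : unplayed p i ->
    \big[Num.min/minimax k (play_round p i i)]_(j | unplayed p j)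
      minimax k (play_round p i j) <= v.
  by apply/bigmax_leP; split=> [|i]; apply: best_le.
move=> pi; have pj := (sv p (right_reach_start _ _)).2 i pi.
apply: (bigmin_inf (s p i)) => //; apply: IH => [|q qr].
  by rewrite -ltnS; apply: leq_trans le_pk; apply: card_unplayed_play_round.
exact/sv/(right_reach_first pi pj qr).
Qed.

(** * Matchings of the auxiliary graph *)

Lemma matching0 n (G : 'I_n -> simple_hot) : matching G set0.
Proof. by split=> [e|e f]; rewrite inE. Qed.

Lemma matching_setU1 n (G : 'I_n -> simple_hot) M e :
  matching G M -> DG_edge G e -> e.1 != e.2 ->
  (forall f, f \in M -> [disjoint endpoints e & endpoints f]) ->
  matching G (e |: M).
Proof.
move=> [edgeM disjM] edge_e loop_e disj_e; split=> [f|f g].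
  by case/setU1P=> [->//|/edgeM].
case/setU1P=> [->|fM] /setU1P[->|gM] neq; first by rewrite eqxx in neq.
- exact: disj_e.
- by rewrite disjoint_sym; apply: disj_e.
- exact: disjM.
Qed.

Definition is_matching n (G : 'I_n -> simple_hot) (M : {set 'I_n * 'I_n}) :=
  [forall e in M, DG_edge G e && (e.1 != e.2)] &&
  [forall e in M, forall f in M,
     (e != f) ==> [disjoint endpoints e & endpoints f]].

Lemma matchingP n (G : 'I_n -> simple_hot) M :
  reflect (matching G M) (is_matching G M).
Proof.
apply: (iffP andP) => [[/'forall_in_andP edgeM /forall_inP disjM]|[edgeM disjM]].
  split=> [e /edgeM //|e f eM fM].
  by move/forall_inP: (disjM e eM) => /(_ f fM)/implyP.
split; first by apply/'forall_in_andP.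
by apply/forall_inP=> e eM; apply/forall_inP=> f fM; apply/implyP/disjM.
Qed.

Lemma min_weight_matching_exists n (G : 'I_n -> simple_hot) :
  exists M, min_weight_matching G M.
Proof.
case: (arg_minP (matching_weight G) (introT (matchingP G set0) (matching0 G))).
by move=> M /matchingP mM minM; exists M; split=> // M' /matchingP/minM.
Qed.

Lemma standard_indexing_le n (G : 'I_n -> simple_hot) (i j : 'I_n) :
  standard_indexing G -> (i <= j)%N ->
  hotL (G j) - hotR (G j) <= hotL (G i) - hotR (G i).
Proof.
move=> hG; case: j => j; elim: j => [|j IH] lt_jn.
  by rewrite leqn0 => /eqP i0; rewrite (_ : Ordinal _ = i) //; apply: val_inj.
rewrite leq_eqVlt => /predU1P[ij|]; last rewrite ltnS.
  by rewrite (_ : Ordinal _ = i) //; apply: val_inj.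
by move/(IH (ltnW lt_jn)); apply: le_trans; apply: hG.
Qed.

(** Starting an edge from its larger end is never better for Left: as
[a_j - c_j <= a_i - c_i], one has [a_j + c_i <= a_i + c_j]. *)
Lemma DG_weight_swap n (G : 'I_n -> simple_hot) (i j : 'I_n) :
  standard_indexing G -> (i <= j)%N -> DG_weight G (j, i) <= DG_weight G (i, j).
Proof.
move=> hG le_ij; rewrite /DG_weight /= eq_sym; case: eqP => // _.
by have := standard_indexing_le hG le_ij; lra.
Qed.

(** * Left plays in index order *)

Lemma index_orderP n (p : position n) i :
  index_order p = Some i ->
  unplayed p i /\ forall j, unplayed p j -> (i <= j)%N.
Proof.
rewrite /index_order; case: pickP => // k /andP[pk /forallP min_k] [<-].
by split=> // j pj; apply: (implyP (min_k j)).
Qed.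

Lemma index_order_neq_None n (p : position n) :
  ~~ finished p -> exists i, index_order p = Some i.
Proof.
case/forallPn=> i0; rewrite negbK => pi0.
rewrite /index_order; case: pickP => [i _|none]; first by exists i.
have [i pi min_i] := arg_minnP (fun i : 'I_n => i : nat) pi0.
by case/negP: (none i); rewrite pi; apply/forallP=> j; apply/implyP/min_i.
Qed.

(** The matching consists of the pairs of negative weight played so far, so the
result exceeds its weight by the total weight of the other pairs. *)
Lemma left_reach_index_order n (G : 'I_n -> simple_hot) q :
  left_reach (@index_order n) (hot_sum G) q ->
  remains_of G q /\
  exists M, [/\ matching G M, matching_weight G M <= result q &
    forall e k, e \in M -> k \in endpoints e -> ~~ unplayed q k].
Proof.
elim=> [|{}q i j _ [Gq [M [mM leM playedM]]] /index_orderP[_ min_i] qi qj].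
  split; first exact: remains_of_hot_sum.
  exists set0; split=> [||e k]; [exact: matching0 | | by rewrite inE].
  by rewrite /matching_weight big_set0 result_hot_sum.
split; first exact: remains_of_play_round.
have played_k e k : e \in M -> k \in endpoints e ->
    ~~ unplayed (play_round q i j) k.
  by move=> eM ke; rewrite unplayed_play_round negb_and (playedM e).
rewrite (result_play_round Gq) //.
have [w_ge0|w_lt0] := leP 0 (DG_weight G (i, j)).
  by exists M; split=> //; lra.
have neq_ij : i != j.
  by apply: contraTneq w_lt0 => ->; rewrite /DG_weight eqxx.
have disj_ij f : f \in M -> [disjoint endpoints (i, j) & endpoints f].
  move=> fM; rewrite disjoint_subset; apply/subsetP=> k kij.
  rewrite inE; apply/negP=> /(playedM f k fM)/negP; apply.
  by case/set2P: kij => ->.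
exists ((i, j) |: M); split.
- apply: matching_setU1 => //; rewrite /DG_edge /= ltn_neqAle neq_ij min_i //=.
  by move: w_lt0; rewrite /DG_weight /= (negPf neq_ij) => ->.
- rewrite /matching_weight big_setU1 /=; first by rewrite addrC lerD2r.
  apply/negP=> ijM; have /(_ _ ijM) := playedM _ i.
  by rewrite !inE eqxx qi => /(_ isT).
- move=> e k /setU1P[->|eM ke]; last exact: (played_k e).
  by case/set2P=> -> /=; rewrite unplayed_play_round eqxx ?andbF.
Qed.

Lemma left_guarantees_index_order n (G : 'I_n -> simple_hot) M :
  min_weight_matching G M ->
  left_guarantees (@index_order n) (hot_sum G) (matching_weight G M).
Proof.
move=> [_ minM] q /left_reach_index_order[_ [M' [mM' leM' _]]]; split=> [_|].
  exact: le_trans (minM M' mM') leM'.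
move=> /index_order_neq_None[i qi]; exists i => //.
by case/index_orderP: qi.
Qed.

(** * Right follows a matching *)

Variant matching_strategy_spec n (M : {set 'I_n * 'I_n}) (i : 'I_n) :
    'I_n -> Prop :=
  | MatchedLow j of (i, j) \in M : matching_strategy_spec M i j
  | MatchedHigh j of (j, i) \in M : matching_strategy_spec M i j
  | Unmatched of (forall e, e \in M -> i \notin endpoints e) :
      matching_strategy_spec M i i.

Lemma matching_strategyP n (M : {set 'I_n * 'I_n}) q i :
  matching_strategy_spec M i (matching_strategy M q i).
Proof.
rewrite /matching_strategy; case: pickP => [j /orP[]|none]; try by constructor.
constructor=> -[k l] klM; apply/negP=> /set2P[] /= i_eq.
  by have := none l; rewrite i_eq klM.
by have := none k; rewrite i_eq klM orbT.
Qed.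


(** The invariant says that the integers already on the board and the edges
still to be played are together worth at most the whole matching. *)
Lemma right_reach_matching n (G : 'I_n -> simple_hot) M q :
  standard_indexing G -> matching G M ->
  right_reach (matching_strategy M) (hot_sum G) q ->
  [/\ remains_of G q,
      forall e, e \in M -> unplayed q e.1 = unplayed q e.2 &
      result q + \sum_(e in M | unplayed q e.1) DG_weight G e
        <= matching_weight G M].
Proof.
move=> hG [edgeM disjM]; elim=> [|{}q i _ [Gq ends_q le_q] qi].
  split=> [|e _|]; [exact: remains_of_hot_sum | by rewrite !unplayed_hot_sum |].
  rewrite result_hot_sum add0r le_eqVlt; apply/predU1P; left.
  by apply: eq_bigl => e; rewrite unplayed_hot_sum andbT.
move: (matching_strategy M q i) (matching_strategyP M q i) => j j_i qj.
(* A round on an edge e0 is worth at most its weight and touches no other edge,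
   so it moves the weight of e0 from the edges still to be played to the
   board. *)
have round_on e0 : e0 \in M -> endpoints e0 = [set i; j] ->
    DG_weight G (i, j) <= DG_weight G e0 ->
  [/\ remains_of G (play_round q i j),
      forall e, e \in M ->
        unplayed (play_round q i j) e.1 = unplayed (play_round q i j) e.2 &
      result (play_round q i j) +
        \sum_(e in M | unplayed (play_round q i j) e.1) DG_weight G e
        <= matching_weight G M].
  move=> e0M e0_ij le_e0.
  have end_e0 k : k \in endpoints e0 -> unplayed q k.
    by rewrite e0_ij => /set2P[]->.
  have unplayed_ends e k : e \in M -> k \in endpoints e ->
      unplayed (play_round q i j) k = unplayed q k && (e != e0).
    move=> eM ke; rewrite unplayed_play_round -negb_or.
    suff -> : (k == i) || (k == j) = (e == e0) by [].
    rewrite -in_set2 -e0_ij; case: (eqVneq e e0) => [<-//|ne].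
    exact: disjointFr (disjM e e0 eM e0M ne) ke.
  split; first exact: remains_of_play_round.
    by move=> e eM; rewrite !(unplayed_ends e) ?ends_q // !inE eqxx ?orbT.
  rewrite (result_play_round Gq) //; apply: le_trans le_q.
  rewrite -addrA lerD2l [leRHS](bigD1 e0) /=; last first.
    by rewrite e0M end_e0 // !inE eqxx.
  apply: lerD => //; rewrite le_eqVlt; apply/predU1P; left.
  apply: eq_bigl => e; case eM: (e \in M) => //=.
  by rewrite (unplayed_ends e) // !inE eqxx.
case: j_i qj round_on => {j} [j ijM|j jiM|free_i] qj round_on.
- exact: (round_on (i, j)).
- apply: (round_on (j, i)) => //; first exact: setUC.
  apply: DG_weight_swap => //.
  have [/orP[/eqP/= -> //|/andP[/ltnW]]] := edgeM _ jiM => //.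
- have same_ends e k : e \in M -> k \in endpoints e ->
      unplayed (play_round q i i) k = unplayed q k.
    move=> eM ke; rewrite unplayed_play_round andbb andb_idr // => _.
    by apply: contraNneq (free_i e eM) => <-.
  split; first exact: remains_of_play_round.
    by move=> e eM; rewrite !(same_ends e) ?ends_q // !inE eqxx ?orbT.
  rewrite (result_play_round Gq) // {1}/DG_weight eqxx addr0.
  apply: le_trans le_q; rewrite lerD2l le_eqVlt; apply/predU1P; left.
  apply: eq_bigl => e; case eM: (e \in M) => //=.
  by rewrite (same_ends e) // !inE eqxx.
Qed.

Lemma right_guarantees_matching n (G : 'I_n -> simple_hot) M :
  standard_indexing G -> matching G M ->
  right_guarantees (matching_strategy M) (hot_sum G) (matching_weight G M).
Proof.
move=> hG mM q /(right_reach_matching hG mM)[_ ends_q le_q]; split.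
  move/forallP=> fin_q; rewrite big_pred0 ?addr0 // in le_q.
  by move=> e; rewrite (negPf (fin_q _)) andbF.
move=> i qi; case: (matching_strategyP M q i) => [j /ends_q|j /ends_q|] //=.
  by move=> <-.
by move=> ->.
Qed.

Lemma minimax_value_hot_sum n (G : 'I_n -> simple_hot) M :
  standard_indexing G -> min_weight_matching G M ->
  minimax_value (hot_sum G) = matching_weight G M.
Proof.
move=> hG minM; apply/le_anti/andP; split.
  exact: right_guarantees_ge_minimax (right_guarantees_matching hG minM.1).
exact: left_guarantees_le_minimax (left_guarantees_index_order minM).
Qed.

Theorem theorem11 (n : nat) (G : 'I_n -> simple_hot)
    (hG : standard_indexing G) :
  left_optimal (@index_order n) (hot_sum G) /\
  (forall M : {set 'I_n * 'I_n}, min_weight_matching G M ->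
     right_optimal (matching_strategy M) (hot_sum G)).
Proof.
split=> [|M minM].
  have [M minM] := min_weight_matching_exists G.
  rewrite /left_optimal (minimax_value_hot_sum hG minM).
  exact: left_guarantees_index_order.
rewrite /right_optimal (minimax_value_hot_sum hG minM).
exact: right_guarantees_matching hG minM.1.
Qed.
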